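(* Let $k>r\ge 4$ and $n>2k+1$. If $H$ is a connected $n$-vertex $r$-graph with $\delta_1(H)\ge\binom{k}{r-1}$, then $\ell(H)\ge 2k$. Moreover, if $\ell(H)=2k$, then for every longest Berge path $P$ in $H$ with edges $e_1,\dots,e_{2k}$ and key vertices $v_0,\dots,v_{2k}$ we have $|K_0(P)|=|K_{2k}(P)|=k$.
   Context: An $r$-graph is a simple $r$-uniform hypergraph; $\delta_1(H)$ is its minimum vertex degree. A Berge path of length $t$ consists of $t+1$ distinct key vertices $v_0,\dots,v_t$ and $t$ distinct edges $e_1,\dots,e_t$ with $\{v_{i-1},v_i\}\subseteq e_i$; $K(P)=\{v_0,\dots,v_t\}$, $E(P)=\{e_1,\dots,e_t\}$. $H$ is connected if every two vertices are joined by a Berge path; $\ell(H)$ is the length of a longest Berge path in $H$. For $a\in[0,t]$, $K_a(P)=\{v_i\in K(P)\setminus\{v_a\}:\ \text{there is } e\in E(H)\setminus E(P) \text{ with } v_a,v_i\in e\}$. *)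

(* Defs.v *)
From mathcomp Require Import all_boot.
Set Implicit Arguments.
Unset Strict Implicit.
Unset Printing Implicit Defensive.

Section Hypergraphs.
Variable V : finType.
Implicit Types (H : {set {set V}}) (x y : V).

(* A simple hypergraph on the vertex set V is identified with its edge set. *)
Definition uniform (r : nat) H : bool := [forall e in H, #|e| == r].

Definition degree H x : nat := #|[set e in H | x \in e]|.

(* The default value #|H| bounds every degree, so for nonempty V this is the
   minimum vertex degree. *)
Definition min_degree H : nat := \big[minn/#|H|]_(x : V) degree H x.

(* Key vertices v_0, ..., v_t and edges e_1, ..., e_t; edges are stored from
   index 0, so tnth e i is e_(i+1) and contains v_i and v_(i+1). *)
Definition berge_path H (t : nat) (v : t.+1.-tuple V) (e : t.-tuple {set V}) :
    bool :=
  [&& uniq v, uniq e, all (mem H) e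
    & [forall i : 'I_t,
        [set tnth v (widen_ord (leqnSn t) i); tnth v (lift ord0 i)]
          \subset tnth e i]].

Definition hconnected H : Prop :=
  forall x y, exists (t : nat) (v : t.+1.-tuple V) (e : t.-tuple {set V}),
    [/\ berge_path H v e, tnth v ord0 = x & tnth v ord_max = y].

Definition has_berge_path H (t : nat) : bool :=
  [exists v : t.+1.-tuple V, [exists e : t.-tuple {set V}, berge_path H v e]].

(* Key vertices are distinct, so every Berge path has length < #|V|. *)
Definition ell H : nat := \max_(t < #|V| | has_berge_path H t) t.

Definition longest_berge_path H (t : nat)
    (v : t.+1.-tuple V) (e : t.-tuple {set V}) : Prop :=
  berge_path H v e /\
  forall (s : nat) (w : s.+1.-tuple V) (f : s.-tuple {set V}),
    berge_path H w f -> s <= t.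

(* K_a(P), for the path P with key vertices v and edges e. *)
Definition Kset H (t : nat) (v : t.+1.-tuple V) (e : t.-tuple {set V})
    (a : 'I_t.+1) : {set V} :=
  [set x in v | (x != tnth v a) &&
     [exists f in H, [&& f \notin e, tnth v a \in f & x \in f]]].

Lemma leq_min_degree H (m : nat) :
  0 < #|V| -> m <= min_degree H <-> forall x, m <= degree H x.
Proof.
move=> /card_gt0P[x0 _]; have degH x : degree H x <= #|H|.
  by apply/subset_leq_card/subsetP => e; rewrite inE => /andP[].
split=> [le_m x | le_m].
  apply: (leq_trans le_m); rewrite /min_degree.
  elim: (index_enum V) (mem_index_enum x) => //= y s IHs.
  rewrite big_cons inE => /predU1P[<-|/IHs]; first exact: geq_minl.
  exact/leq_trans/geq_minr.
rewrite /min_degree; elim/big_ind: _ => [|a b ma mb|x _] //.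
- exact: leq_trans (le_m x0) (degH x0).
- by rewrite leq_min ma mb.
Qed.

Lemma leq_ell H (t : nat) (v : t.+1.-tuple V) (e : t.-tuple {set V}) :
  berge_path H v e -> t <= ell H.
Proof.
move=> Pve; have lt_tV : t < #|V|.
  case/and4P: Pve => /card_uniqP + _ _ _; rewrite size_tuple => <-.
  exact: max_card.
apply: (@leq_bigmax_cond _ _ _ (Ordinal lt_tV)).
by apply/existsP; exists v; apply/existsP; exists e.
Qed.

Lemma ell_attained H : 0 < #|V| ->
  exists (v : (ell H).+1.-tuple V) (e : (ell H).-tuple {set V}),
    berge_path H v e.
Proof.
move=> V_gt0; have [x _] := card_gt0P V_gt0.
have P0 : has_berge_path H (Ordinal V_gt0).
  apply/existsP; exists [tuple x]; apply/existsP; exists [tuple].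
  by apply/and4P; split=> //; apply/forallP; case.
have [|i Pi eq_i] := @eq_bigmax_cond _ [pred t : 'I_#|V| | has_berge_path H t]
  (fun t => nat_of_ord t); first by apply/card_gt0P; exists (Ordinal V_gt0).
have -> : ell H = i by rewrite -eq_i.
by case/existsP: Pi => v /existsP[e Pve]; exists v, e.
Qed.

End Hypergraphs.

(* Main.v *)
(* Let P be a longest Berge path, of length t <= 2k.  An edge outside P through
   both ends would close a Berge cycle on K(P), which connectedness and
   n > t + 1 turn into a longer path.  Hence, by rotations, no index i has
   v_(i-1) in K_t together with v_i in K_0 or v_0 in e_i, so that
   |K_0| + |K_t| <= t, and a + |K_t| <= t where a is the number of edges of P
   containing v_0.
   It remains to see |K_0| >= k.  Edges outside P through v_0 lie inside
   K_0 + v_0; if |K_0| < k, the degree condition forces a >= D := C(k-1, r-2),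
   hence |K_t| <= 2k - D < k and v_t also lies in D edges of P.  For every i
   with v_0 in e_i, a rotation makes v_(i-1) the first vertex without changing
   the edges or the last vertex, so v_(i-1) also lies in D edges of P.  Counting
   incidences on P gives (D + 1) D <= 2kr, which is false for k > r >= 4. *)
Require Import Defs.
From mathcomp Require Import all_boot zify.

Set Implicit Arguments.
Unset Strict Implicit.
Unset Printing Implicit Defensive.

(** * Paired counting and binomial estimates *)

Lemma count_disjoint (S T : Type) (x0 : S) (y0 : T) (a : pred S) (b : pred T)
    (s1 : seq S) (s2 : seq T) :
  size s1 = size s2 ->
  (forall i, i < size s1 -> a (nth x0 s1 i) -> ~~ b (nth y0 s2 i)) ->
  count a s1 + count b s2 <= size s1.
Proof.
elim: s1 s2 => [|x s1 IH] [|y s2] //= [eq_s] dis.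
have le_s : count a s1 + count b s2 <= size s1.
  by apply: IH eq_s _ => i lt_i; exact: (dis i.+1 lt_i).
have := dis 0 isT; rewrite /=.
by case: (a x) => [/(_ isT)/negbTE ->|_]; case: (b y) => /=; lia.
Qed.

Lemma count_mem_card (T : finType) (A : {set T}) (s : seq T) :
  uniq s -> {subset A <= s} -> count (mem A) s = #|A|.
Proof.
move=> Us sAs; rewrite -size_filter -(card_uniqP (filter_uniq _ Us)).
by apply: eq_card => y; rewrite mem_filter; apply: andb_idr => /sAs.
Qed.

(** Unimodality of a row of Pascal's triangle, by Pascal's rule; in the extremal case j + s = m both
    sides agree by symmetry. *)
Lemma leq_bin_symm s j m : s <= j -> j + s <= m -> 'C(m, s) <= 'C(m, j).
Proof.
elim: m s j => [|m IH] [|s] [|j] //=; rewrite ?bin0 ?bin_gt0 //; try lia.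
move=> le_sj le_jm; have [eq_m|neq_m] := eqVneq (j.+1 + s.+1) m.+1.
  have -> : s.+1 = m.+1 - j.+1 by lia.
  by rewrite bin_sub //; lia.
by rewrite !binS leq_add // IH //; lia.
Qed.

(** Numerical end of the incidence count. At k = 5, D = 6 the last inequality is tight: 40 < 42. *)
Lemma half_mul_pred_large k D : 5 <= k -> (k.-1 * k.-2)./2 <= D ->
  k < D /\ 2 * k * k.-1 < D.+1 * D.
Proof.
move=> hk; have [m -> {k hk}] : exists m, k = m + 5 by exists (k - 5); lia.
have -> : (m + 5).-1 = m + 4 by lia.
have -> : (m + 4).-1 = m + 3 by lia.
(* Undoing the rounded half costs one. *)
move=> leD; have {leD} : (m + 4) * (m + 3) <= D.*2.+1 by lia.
move: D => D leD; have gtD : m + 5 < D by nia.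
split=> //; rewrite ltnNge; apply/negP => incD.
(* Completing the square: 4D(D + 1) + 1 = (2D + 1)^2. *)
have : D.*2.+1 * D.*2.+1 <= 8 * (m + 5) * (m + 4) + 1 by lia.
nia.
Qed.

(** * Berge paths as lists of vertices and edges *)

Lemma tval_thead (T : Type) t (v : t.+1.-tuple T) :
  tval v = thead v :: behead v.
Proof. by rewrite {1}[v]tuple_eta. Qed.

Lemma last_thead (T : Type) t (v : t.+1.-tuple T) :
  last (thead v) (behead v) = tnth v ord_max.
Proof.
rewrite (tnth_nth (thead v)) tval_thead (last_nth (thead v)).
by rewrite size_behead size_tuple.
Qed.

Section Walks.
Variables (V : finType) (H : {set {set V}}).
Implicit Types (x y w : V) (p : seq V) (es : seq {set V}) (f g h : {set V}).

(** Lists can be cut, reversed and glued. The first key vertex stays apart, so that the other keys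
    and the edges are matched index by index. *)
Fixpoint walk x p es : bool :=
  match p, es with
  | [::], [::] => true
  | y :: p', f :: es' => [&& x \in f, y \in f & walk y p' es']
  | _, _ => false
  end.

Definition path_of x p es : bool :=
  [&& uniq (x :: p), uniq es, all (mem H) es & walk x p es].

Lemma walk_size x p es : walk x p es -> size p = size es.
Proof. by elim: p x es => [|y p IH] x [|f es] //= /and3P[_ _ /IH ->]. Qed.

(** Indexed form: [nth x (x :: p) i], [nth x p i] and [nth set0 es i] are v_i, v_(i+1) and
    e_(i+1). *)
Lemma walkP x p es :
  reflect (size p = size es /\ forall i, i < size es ->
             (nth x (x :: p) i \in nth set0 es i)
             && (nth x p i \in nth set0 es i))
          (walk x p es).
Proof.
elim: p x es => [|y p IH] x [|f es] /=; try by constructor; case.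
  by constructor; split.
apply: (iffP and3P) => [[xf yf /IH[eq_s in_es]]|[[eq_s] in_es]].
  split=> [|[|i] lt_i]; [by rewrite eq_s | by rewrite /= xf yf |].
  have lt_ip : i < size p by rewrite eq_s.
  have := in_es i lt_i; rewrite !(set_nth_default x y) //=.
  exact: ltnW.
have /andP[xf yf] := in_es 0 isT; split=> //; apply/IH; split=> // i lt_i.
have lt_ip : i < size p by rewrite eq_s.
have := in_es i.+1 lt_i; rewrite /= !(set_nth_default y x) //=.
exact: ltnW.
Qed.

Lemma walk_cat x p1 p2 es1 es2 : size p1 = size es1 ->
  walk x (p1 ++ p2) (es1 ++ es2) =
  walk x p1 es1 && walk (last x p1) p2 es2.
Proof.
elim: p1 x es1 => [|y p1 IH] x [|f es1] //= [eq_s].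
by rewrite IH // !andbA.
Qed.

Lemma last_rev_belast x p : last (last x p) (rev (belast x p)) = x.
Proof. by case: p => //= y p; rewrite rev_cons last_rcons. Qed.

Lemma walk_rev x p es :
  walk x p es -> walk (last x p) (rev (belast x p)) (rev es).
Proof.
elim: p x es => [|y p IH] x [|f es] //= /and3P[xf yf w].
rewrite !rev_cons -!cats1 walk_cat ?IH //=; last first.
  by rewrite !size_rev size_belast (walk_size w).
by rewrite last_rev_belast xf yf.
Qed.

Lemma rev_keys x p : last x p :: rev (belast x p) = rev (x :: p).
Proof. by rewrite [x :: p]lastI rev_rcons. Qed.

Lemma walk_split x p es i : walk x p es -> i < size es ->
  exists p1 p2 es1 es2,
    [/\ p = p1 ++ nth x p i :: p2, es = es1 ++ nth set0 es i :: es2,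
        size p1 = size es1 & last x p1 = nth x (x :: p) i].
Proof.
move=> /walk_size sp lt_i; have lt_ip : i < size p by rewrite sp.
exists (take i p), (drop i.+1 p), (take i es), (drop i.+1 es); split.
- by rewrite -drop_nth // cat_take_drop.
- by rewrite -drop_nth // cat_take_drop.
- by rewrite !size_takel // ltnW.
- rewrite (last_nth x) size_takel 1?ltnW //.
  by rewrite -[x :: take i p]/(take i.+1 (x :: p)) nth_take.
Qed.

(** * Reversal, extension and rotation of paths *)

Lemma path_of_rev x p es :
  path_of x p es -> path_of (last x p) (rev (belast x p)) (rev es).
Proof.
case/and4P=> Up Ue He w; apply/and4P; split.
- by rewrite rev_keys rev_uniq.
- by rewrite rev_uniq.
- by rewrite all_rev.
- exact: walk_rev.
Qed.

Lemma path_of_cons w x p es f :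
  path_of x p es -> f \in H -> f \notin es -> x \in f -> w \in f ->
  w \notin x :: p -> path_of w (x :: p) (f :: es).
Proof.
case/and4P=> Up Ue He wk Hf fes xf wf wxp.
by apply/and4P; split; rewrite /= -/(uniq (x :: p)) ?wxp ?fes ?Hf ?wf ?xf.
Qed.

(** Pósa rotation: v_i, ..., v_0 is traversed backwards, then [g] leads to y = v_(i+1). The dropped
    edge [h] may itself serve as [g]. *)
Lemma path_of_posa x y p1 p2 es1 es2 h g :
  size p1 = size es1 -> path_of x (p1 ++ y :: p2) (es1 ++ h :: es2) ->
  g \in H -> g \notin es1 ++ es2 -> x \in g -> y \in g ->
  path_of (last x p1) (rev (belast x p1) ++ y :: p2) (rev es1 ++ g :: es2).
Proof.
move=> eq_s /and4P[Up Ue He wk] Hg ges xg yg.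
move: wk; rewrite walk_cat //= => /and4P[w1 _ _ w2].
apply/and4P; split.
- rewrite -cat_cons rev_keys -(@perm_uniq _ (x :: p1 ++ y :: p2)) //.
  by rewrite -cat_cons perm_cat2r perm_sym perm_rev.
- rewrite (@perm_uniq _ _ (g :: es1 ++ es2)) /=; last first.
    by rewrite -cat1s perm_catCA perm_cons perm_cat2r perm_rev.
  rewrite ges; apply: subseq_uniq Ue.
  by apply: cat_subseq => //; exact: subseq_cons.
- move: He; rewrite !all_cat all_rev /= => /and3P[-> _ ->].
  by rewrite Hg.
- rewrite walk_cat; last by rewrite !size_rev size_belast.
  by rewrite walk_rev //= last_rev_belast xg yg.
Qed.

(** The edge [f] closes the path to a Berge cycle, which is reopened at [h]. *)
Lemma path_of_cycle_rot x y p1 p2 es1 es2 h f :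
  size p1 = size es1 -> path_of x (p1 ++ y :: p2) (es1 ++ h :: es2) ->
  f \in H -> f \notin es1 ++ es2 -> x \in f -> last y p2 \in f ->
  path_of y (p2 ++ x :: p1) (es2 ++ f :: es1).
Proof.
move=> eq_s /and4P[Up Ue He wk] Hf fes xf lf.
move: wk; rewrite walk_cat //= => /and4P[w1 _ _ w2].
apply/and4P; split.
- rewrite -cat_cons (@perm_uniq _ _ (x :: p1 ++ y :: p2)) //.
  by rewrite -[x :: p1 ++ _]cat_cons perm_catC.
- rewrite (@perm_uniq _ _ (f :: es1 ++ es2)) /=; last first.
    by rewrite -cat1s perm_catCA perm_cons perm_catC.
  rewrite fes; apply: subseq_uniq Ue.
  by apply: cat_subseq => //; exact: subseq_cons.
- by move: He; rewrite !all_cat /= Hf => /and3P[-> _ ->].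
- rewrite walk_cat; last exact: walk_size w2.
  by rewrite w2 /= lf xf.
Qed.

Lemma walk_leave (A : {pred V}) x p es :
  walk x p es -> x \in A -> last x p \notin A ->
  exists f u w, [/\ f \in es, u \in f, w \in f, u \in A & w \notin A].
Proof.
elim: p x es => [|y p IH] x [|f es] //=; first by move=> _ ->.
case/and3P=> xf yf wk xA lA; have [yA|yA] := boolP (y \in A).
  have [g [u [w [ges ug wg uA wA]]]] := IH _ _ wk yA lA.
  by exists g, u, w; split=> //; rewrite inE ges orbT.
by exists f, x, y; split=> //; rewrite inE eqxx.
Qed.

(** * Passage between tuples and lists *)

Lemma berge_path_of t (v : t.+1.-tuple V) (e : t.-tuple {set V}) :
  berge_path H v e = path_of (thead v) (behead v) e.
Proof.
have vE := tval_thead v.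
rewrite /berge_path /path_of -vE; congr [&& _, _, _ & _].
have sb : size (behead v) = t by rewrite size_behead size_tuple.
apply/forallP/walkP => [in_e|[_ in_e] i].
  rewrite size_tuple; split=> // i lt_i.
  have := in_e (Ordinal lt_i); rewrite subUset !sub1set.
  by rewrite !(tnth_nth (thead v)) (tnth_nth set0) /= vE.
have := in_e i; rewrite size_tuple => /(_ (ltn_ord i)).
by rewrite subUset !sub1set !(tnth_nth (thead v)) (tnth_nth set0) /= vE.
Qed.

Lemma path_of_berge x p es : path_of x p es ->
  exists (v : (size es).+1.-tuple V) (e : (size es).-tuple {set V}),
    berge_path H v e.
Proof.
move=> P; have /and4P[_ _ _ /walk_size eq_s] := P.
have szv : size (x :: p) == (size es).+1 by rewrite /= eq_s.
exists (Tuple szv), (in_tuple es); rewrite berge_path_of /=.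
by rewrite /thead (tnth_nth x).
Qed.

(** [Kset] without the demand that the vertex lie on the path; it depends only on which edges are
    used. At an end of a longest path the demand holds automatically, by [Kout_sub]. *)
Definition Kout es x : {set V} :=
  [set y | (y != x) && [exists f in H, [&& f \notin es, x \in f & y \in f]]].

Lemma KoutP es x y :
  reflect (y != x /\ exists f, [/\ f \in H, f \notin es, x \in f & y \in f])
          (y \in Kout es x).
Proof.
rewrite inE; apply: (iffP andP) => -[yx].
  by case/exists_inP=> f Hf /and3P[fes xf yf]; split=> //; exists f.
case=> f [Hf fes xf yf]; split=> //; apply/exists_inP; exists f => //.
exact/and3P.
Qed.

Lemma Kout_rev es x : Kout (rev es) x = Kout es x.
Proof.
apply/setP=> y; rewrite !inE; congr (_ && _).
by apply: eq_existsb => f; rewrite mem_rev.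
Qed.

(** * Longest paths in a connected hypergraph *)

Section Longest.
Variable t : nat.
Hypothesis max_t : forall x p es, path_of x p es -> size es <= t.

Lemma longest_edge_sub x p es f : path_of x p es -> size es = t ->
  f \in H -> f \notin es -> x \in f -> {subset f <= x :: p}.
Proof.
move=> P eq_t Hf fes xf w wf; apply: contraT => wxp.
by have := max_t (path_of_cons P Hf fes xf wf wxp); rewrite /= eq_t ltnn.
Qed.

Lemma Kout_sub x p es : path_of x p es -> size es = t ->
  {subset Kout es x <= p}.
Proof.
move=> P eq_t y /KoutP[yx [f [Hf fes xf yf]]].
have := longest_edge_sub P eq_t Hf fes xf yf.
by rewrite inE (negbTE yx).
Qed.

(** Edges at [x] off the path inject, by removal of [x], into the (r - 1)-subsets of [Kout es x]. *)
Lemma degree_Kout r x p es : uniform r H -> path_of x p es -> size es = t ->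
  degree H x <= 'C(#|Kout es x|, r - 1) + count (fun f => x \in f) es.
Proof.
move=> uH P eq_t; rewrite /degree.
rewrite -(cardsID [set f in es]) addnC leq_add //; last first.
  rewrite -size_filter; apply: leq_trans (card_size _).
  apply/subset_leq_card/subsetP => f; rewrite !inE mem_filter.
  by case/andP=> /andP[_ ->] ->.
rewrite -cards_draws -(card_in_imset (f := fun f => f :\ x)); last first.
  move=> f g; rewrite !inE => /and3P[_ _ xf] /and3P[_ _ xg] eq_fg.
  by rewrite -(setD1K xf) -(setD1K xg) eq_fg.
apply/subset_leq_card/subsetP => _ /imsetP[f + ->].
rewrite !inE => /and3P[fes Hf xf]; apply/andP; split.
  apply/subsetP=> y; rewrite in_setD1 => /andP[yx yf].
  by apply/KoutP; split=> //; exists f.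
move/forall_inP: uH => /(_ f Hf)/eqP <-.
by rewrite (cardsD1 x f) xf add1n subn1.
Qed.

Hypotheses (conn : hconnected H) (lt_tV : t.+1 < #|V|).

Lemma leaving_edge x p es : path_of x p es -> size es = t ->
  exists f u w,
    [/\ f \in H, u \in f, w \in f, u \in x :: p & w \notin x :: p].
Proof.
move=> /and4P[_ _ _ /walk_size sp] eq_t.
have [w wxp] : exists w, w \notin x :: p.
  apply/existsP; rewrite -negb_forall; apply: contraTN lt_tV => /forallP all_xp.
  rewrite -leqNgt -eq_t -sp; apply: leq_trans (card_size (x :: p)).
  by apply/subset_leq_card/subsetP => y _.
have [s [v [e [Pve v0 vs]]]] := conn x w.
move: Pve; rewrite berge_path_of => /and4P[_ _ /allP He wk].
have xA : thead v \in x :: p by rewrite /thead v0 mem_head.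
rewrite -vs -last_thead in wxp.
have [f [u [w' [fe uf wf uA wA]]]] := walk_leave wk xA wxp.
by exists f, u, w'; split=> //; exact: He.
Qed.

(** Some edge [h] joins a key u to a vertex w off the path. Reopening the cycle so that it starts in
    [h] without using [h] lets w be prepended. *)
Lemma no_closing_edge x p es f : path_of x p es -> size es = t ->
  f \in H -> f \notin es -> x \in f -> last x p \notin f.
Proof.
move=> P eq_t Hf fes xf; apply/negP => lf.
have [h [u [w [Hh uh wh uxp wxp]]]] := leaving_edge P eq_t.
have /and4P[_ _ _ wk] := P; have sp := walk_size wk.
have stuck y q es' : path_of y q es' -> size es' = t -> y :: q =i x :: p ->
    h \notin es' -> y \notin h.
  move=> P' eq_t' eq_q hes; apply: contra wxp => yh.
  by rewrite -eq_q (longest_edge_sub P' eq_t' Hh hes yh wh).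
have [eq_hf|neq_hf] := eqVneq h f.
  by move: (stuck x p es P eq_t (fun=> erefl)); rewrite eq_hf xf => /(_ fes).
have rot i : i < size es ->
    h = nth set0 es i \/ h \notin es -> nth x p i \notin h.
  move=> lt_i hi; have [p1 [p2 [es1 [es2]]]] := walk_split wk lt_i.
  move: (nth x p i) (nth set0 es i) hi => y g hi [eq_p eq_es s1 _].
  subst p es.
  have fes' : f \notin es1 ++ es2.
    by apply: contra fes; rewrite !mem_cat inE => /orP[] ->; rewrite ?orbT.
  have lyf : last y p2 \in f by rewrite last_cat in lf.
  have P' := path_of_cycle_rot s1 P Hf fes' xf lyf.
  apply: stuck P' _ _ _.
  - by rewrite -eq_t !size_cat /= !addnS addnC.
  - by move=> z; rewrite -cat_cons -[x :: _ ++ _]cat_cons !mem_cat orbC.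
  have /and4P[_ Ue _ _] := P.
  have : h \notin es1 ++ es2.
    case: hi => [->|]; last first.
      by apply: contra; rewrite !mem_cat inE => /orP[] ->; rewrite ?orbT.
    by move: Ue; rewrite -cat1s uniq_catCA /= => /andP[].
  by rewrite !(mem_cat, inE) (negbTE neq_hf) orbC.
(* If [h] lies on the path, the cycle is reopened at [h] itself; otherwise at the edge leading to u,
   unless u = x. *)
have [hes|hes] := boolP (h \in es).
  have lt_i : index h es < size es by rewrite index_mem.
  have hE := nth_index set0 hes.
  have := rot _ lt_i (or_introl (esym hE)).
  by have /walkP[_ /(_ _ lt_i)] := wk; rewrite hE => /andP[_ ->].
move: uxp; rewrite inE => /orP[/eqP ux|up].
  by have := stuck x p es P eq_t (fun=> erefl) hes; rewrite -ux uh.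
have lt_i : index u p < size es by rewrite -sp index_mem.
by have := rot _ lt_i (or_intror hes); rewrite nth_index ?uh.
Qed.

(** Were [x] in [g], rotation by [g] would give a path from v_i to v_t, closed by [f]. The two
    options for [g] serve the two counts below. *)
Lemma no_crossing x p es i f g : path_of x p es -> size es = t -> i < t ->
  f \in H -> f \notin es -> nth x (x :: p) i \in f -> last x p \in f ->
  g \in H -> g = nth set0 es i \/ g \notin es -> nth x p i \in g ->
  x \notin g.
Proof.
move=> P eq_t lt_it Hf fes if_ lf Hg gi ig; apply/negP => xg.
have /and4P[_ Ue _ wk] := P.
have lt_i : i < size es by rewrite eq_t.
have [p1 [p2 [es1 [es2]]]] := walk_split wk lt_i.
move: (nth x p i) (nth set0 es i) (nth x (x :: p) i) gi ig if_.
move=> y h z gi ig zf [eq_p eq_es s1 eq_z]; subst p es z.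
have ges : g \notin es1 ++ es2.
  case: gi => [->|]; last first.
    by apply: contra; rewrite !mem_cat inE => /orP[] ->; rewrite ?orbT.
  by move: Ue; rewrite -cat1s uniq_catCA /= => /andP[].
have P' := path_of_posa s1 P Hg ges xg ig.
have eq_t' : size (rev es1 ++ g :: es2) = t.
  by rewrite -eq_t !size_cat size_rev.
(* If f = g, this edge already closes the original path. *)
have [eq_fg|neq_fg] := eqVneq f g.
  have := no_closing_edge P eq_t Hf fes.
  by rewrite eq_fg xg -eq_fg lf => /(_ isT).
have fes' : f \notin rev es1 ++ g :: es2.
  move: fes; rewrite !mem_cat !inE mem_rev (negbTE neq_fg).
  by rewrite !negb_or => /and3P[-> _ ->].
have := no_closing_edge P' eq_t' Hf fes' zf.
by move: lf; rewrite !last_cat /= => ->.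
Qed.

Lemma Kout_end_count x p es : path_of x p es -> size es = t ->
  count (mem (Kout es (last x p))) (belast x p) = #|Kout es (last x p)|.
Proof.
move=> P eq_t; have /and4P[Up _ _ _] := P.
apply: count_mem_card => [|y yK].
  by move: Up; rewrite lastI rcons_uniq => /andP[].
have := Kout_sub (path_of_rev P); rewrite size_rev => /(_ eq_t y).
by rewrite mem_rev Kout_rev; apply.
Qed.

Lemma nth_belast x p i : i < size p -> nth x (belast x p) i = nth x (x :: p) i.
Proof. by move=> lt_i; rewrite lastI nth_rcons size_belast lt_i. Qed.

Lemma Kout_ends x p es : path_of x p es -> size es = t ->
  #|Kout es x| + #|Kout es (last x p)| <= t.
Proof.
move=> P eq_t; have /and4P[Up _ _ wk] := P; have sp := walk_size wk.
rewrite -(Kout_end_count P eq_t) -(@count_mem_card _ _ p); last first.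
- exact: Kout_sub P eq_t.
- by case/andP: Up.
(* Index i pairs v_(i+1) in [p] with v_i in [belast x p]. *)
rewrite -eq_t -sp; apply: (count_disjoint (x0 := x) (y0 := x)).
  by rewrite size_belast.
move=> i lt_i /= /KoutP[_ [g [Hg ges xg ig]]]; rewrite nth_belast //.
apply/negP => /KoutP[_ [f [Hf fes lf if_]]].
have lt_it : i < t by rewrite -eq_t -sp.
have := no_crossing P eq_t lt_it Hf fes if_ lf Hg (or_intror ges) ig.
by rewrite xg.
Qed.

Lemma count_start_Kout_end x p es : path_of x p es -> size es = t ->
  count (fun f => x \in f) es + #|Kout es (last x p)| <= t.
Proof.
move=> P eq_t; have /and4P[_ _ /allP He wk] := P; have sp := walk_size wk.
rewrite -(Kout_end_count P eq_t) -eq_t.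
(* Here e_(i+1) is paired with v_i, and e_(i+1) plays the role of [g]. *)
apply: (count_disjoint (x0 := set0) (y0 := x)).
  by rewrite size_belast.
move=> i lt_i /= xi; rewrite nth_belast ?sp //.
apply/negP => /KoutP[_ [f [Hf fes lf if_]]].
have lt_it : i < t by rewrite -eq_t.
have Hi : nth set0 es i \in H by apply/He/mem_nth.
have ig : nth x p i \in nth set0 es i.
  by have /walkP[_ /(_ _ lt_i)/andP[]] := wk.
have := no_crossing P eq_t lt_it Hf fes if_ lf Hi (or_introl erefl) ig.
by rewrite xi.
Qed.

Lemma count_end_Kout_start x p es : path_of x p es -> size es = t ->
  count (fun f => last x p \in f) es + #|Kout es x| <= t.
Proof.
move=> P eq_t; have := count_start_Kout_end (path_of_rev P).
rewrite size_rev last_rev_belast count_rev Kout_rev; exact.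
Qed.

(** Pósa rotation with e_(i+1) reused as the connecting edge, so no edge is exchanged. *)
Lemma path_of_rotate_start x p es i : path_of x p es -> i < size es ->
  x \in nth set0 es i ->
  exists p' es', [/\ path_of (nth x (x :: p) i) p' es', perm_eq es' es
                   & last (nth x (x :: p) i) p' = last x p].
Proof.
move=> P lt_i; have /and4P[_ Ue /allP He wk] := P.
have Hi : nth set0 es i \in H by apply/He/mem_nth.
have ig : nth x p i \in nth set0 es i.
  by have /walkP[_ /(_ _ lt_i)/andP[]] := wk.
have [p1 [p2 [es1 [es2]]]] := walk_split wk lt_i.
move: (nth x p i) (nth set0 es i) (nth x (x :: p) i) Hi ig.
move=> y h z Hh yh [eq_p eq_es s1 <-] xh; subst p es.
have hes : h \notin es1 ++ es2.
  by move: Ue; rewrite -cat1s uniq_catCA /= => /andP[].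
exists (rev (belast x p1) ++ y :: p2), (rev es1 ++ h :: es2); split.
- exact: path_of_posa P Hh hes xh yh.
- by rewrite perm_cat2r perm_rev.
- by rewrite !last_cat.
Qed.

(** * Consequences of the degree condition *)

Section LargeDegree.
Variables k r : nat.
Hypotheses (hr : 4 <= r) (hkr : r < k) (le_t2k : t <= 2 * k).
Hypotheses (uH : uniform r H) (degH : forall x, 'C(k, r - 1) <= degree H x).

(** By Pascal's rule, C(k - 1, r - 2) is what remains of the degree after at most C(k - 1, r - 1)
    edges off the path. *)
Lemma count_start_large x p es : path_of x p es -> size es = t ->
  #|Kout es x| < k -> 'C(k.-1, r - 2) <= count (fun f => x \in f) es.
Proof.
move=> P eq_t ltK; have := leq_trans (degH x) (degree_Kout uH P eq_t).
have -> : 'C(k, r - 1) = 'C(k.-1, r - 1) + 'C(k.-1, r - 2).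
  have -> : r - 1 = (r - 2).+1 by lia.
  have {1}-> : k = k.-1.+1 by lia.
  by rewrite binS.
have : 'C(#|Kout es x|, r - 1) <= 'C(k.-1, r - 1) by apply: leq_bin2l; lia.
lia.
Qed.

Lemma bin2_leq_bin : (k.-1 * k.-2)./2 <= 'C(k.-1, r - 2).
(* The range 2 <= r - 2 <= (k - 1) - 2 is exactly 4 <= r < k. *)
Proof. by rewrite -bin2; apply: leq_bin_symm; lia. Qed.

Lemma sum_incidences es :
  all (mem H) es -> \sum_x count (fun f => x \in f) es = size es * r.
Proof.
elim: es => [_|f es IH /= /andP[Hf Hes]]; first by rewrite big1.
rewrite big_split /= IH // mulSn; congr (_ + _).
rewrite -(eqP (forall_inP uH f Hf)) -sum1_card [RHS]big_mkcond /=.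
by apply: eq_bigr => x _; case: (x \in f).
Qed.

Lemma Kout_start_large x p es : path_of x p es -> size es = t ->
  k <= #|Kout es x|.
Proof.
move=> P eq_t; rewrite leqNgt; apply/negP => ltK.
set D := 'C(k.-1, r - 2); have leD : (k.-1 * k.-2)./2 <= D := bin2_leq_bin.
have [gtD incD] : k < D /\ 2 * k * k.-1 < D.+1 * D.
  by apply: half_mul_pred_large leD; lia.
have aD := count_start_large P eq_t ltK.
have aK := count_start_Kout_end P eq_t.
have Prev := path_of_rev P.
(* |K_t| <= 2k - D < k, so the reversed path satisfies the same hypothesis. *)
have bD : D <= count (fun f => last x p \in f) es.
  rewrite -[count _ _]count_rev; apply: count_start_large Prev _ _.
    by rewrite size_rev.
  by rewrite Kout_rev; rewrite -/D in aD; lia.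
have bK := count_end_Kout_start P eq_t.
pose S := [set u | D <= count (fun f => u \in f) es].
have /and4P[Up _ Hes wk] := P; have sp := walk_size wk.
(* If v_0 is in e_(i+1), then v_i is in [S]; hence e_(i+1) is paired with v_i lying outside [S]. *)
have aS : count (fun f => x \in f) es <= count (mem S) (belast x p).
  have := @count_disjoint _ _ set0 x (fun f => x \in f) (predC (mem S)) es
    (belast x p).
  rewrite size_belast sp => /(_ erefl) dis.
  have := count_predC (mem S) (belast x p); rewrite size_belast sp => cS.
  rewrite -(leq_add2r (count (predC (mem S)) (belast x p))) cS.
  apply: dis => i lt_i xi; rewrite nth_belast ?sp //= negbK inE.
  have [p' [es' [P' perm_es last_p']]] := path_of_rotate_start P lt_i xi.
  have eq_t' : size es' = t by rewrite (perm_size perm_es).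
  (* The rotated path keeps its last vertex and its edges, so [bD] still bounds the [Kout] of its
     new start below k. *)
  have := count_end_Kout_start P' eq_t'.
  rewrite last_p' (permP perm_es) => /(leq_trans (leq_add bD (leqnn _))) bK'.
  by rewrite -(permP perm_es); apply: count_start_large P' eq_t' _; lia.
(* At least D members of [S] precede v_t on the path, and v_t is one more. *)
have S_large : D < #|S|.
  have lS : last x p \in S by rewrite inE.
  have : count (mem S) (x :: p) <= #|S|.
    rewrite -size_filter -(card_uniqP (filter_uniq _ Up)).
    by apply/subset_leq_card/subsetP => y; rewrite mem_filter => /andP[].
  rewrite lastI -cats1 count_cat /= lS; rewrite -/D in aD; lia.
have := sum_incidences Hes; rewrite eq_t => inc.
have : #|S| * D <= t * r.
  rewrite -inc (bigID (mem S)) /= -sum_nat_const.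
  apply: leq_trans (leq_addr _ _); apply: leq_sum => u.
  by rewrite inE.
have : D.+1 * D <= #|S| * D by rewrite leq_mul2r S_large orbT.
(* Uses t <= 2k and r <= k - 1. *)
have : t * r <= 2 * k * k.-1 by apply: leq_mul => //; lia.
move=> ub lb1 lb2; have := leq_trans lb1 (leq_trans lb2 ub).
by rewrite leqNgt incD.
Qed.

(** Both sets have size at least k, while their sizes sum to at most t <= 2k; all these bounds are
    equalities. *)
Lemma Kout_longest x p es : path_of x p es -> size es = t ->
  [/\ t = 2 * k, #|Kout es x| = k & #|Kout es (last x p)| = k].
Proof.
move=> P eq_t; have leK0 := Kout_start_large P eq_t.
have leKt : k <= #|Kout es (last x p)|.
  have := Kout_start_large (path_of_rev P); rewrite size_rev Kout_rev.
  exact.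
have := Kout_ends P eq_t; split; lia.
Qed.

End LargeDegree.
End Longest.

(** * Return to tuples and the theorem *)

Lemma Kset_Kout t (v : t.+1.-tuple V) (e : t.-tuple {set V}) (a : 'I_t.+1) :
  {subset Kout e (tnth v a) <= v} -> Kset H v e a = Kout e (tnth v a).
Proof.
move=> sub_v; apply/setP=> y; rewrite -[RHS](andb_idl (@sub_v y)) !inE.
by [].
Qed.

End Walks.

Theorem theorem3p1 (k r n : nat) (hr : 4 <= r) (hkr : r < k)
    (hn : 2 * k + 1 < n)
    (V : finType) (hV : #|V| = n)
    (H : {set {set V}}) (hH : uniform r H) (hconn : hconnected H)
    (hdeg : 'C(k, r - 1) <= min_degree H) :
  2 * k <= ell H /\
  (ell H = 2 * k ->
   forall (v : (2 * k).+1.-tuple V) (e : (2 * k).-tuple {set V}),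
     longest_berge_path H v e ->
     #|Kset H v e ord0| = k /\ #|Kset H v e ord_max| = k).
Proof.
have V_gt0 : 0 < #|V| by lia.
move/(leq_min_degree H _ V_gt0): hdeg => degH.
have max_ell x p es : path_of H x p es -> size es <= ell H.
  by case/path_of_berge=> v [e /leq_ell].
split.
  rewrite leqNgt; apply/negP => lt_ell.
  have [v [e]] := ell_attained H V_gt0; rewrite berge_path_of => P.
  have lt_V : (ell H).+1 < #|V| by lia.
  (* A maximum length below 2k would still have to equal 2k. *)
  have [] := Kout_longest max_ell hconn lt_V hr hkr (ltnW lt_ell) hH degH P.
    by rewrite size_tuple.
  lia.
move=> eq_ell v e [+ _]; rewrite berge_path_of eq_ell in max_ell * => P.
have lt_V : (2 * k).+1 < #|V| by lia.
have eq_t : size e = 2 * k by rewrite size_tuple.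
have [_ K0 Kt] :=
  Kout_longest max_ell hconn lt_V hr hkr (leqnn _) hH degH P eq_t.
have subK0 := Kout_sub max_ell P eq_t.
have subKt := Kout_sub max_ell (path_of_rev P); rewrite size_rev in subKt.
rewrite !Kset_Kout.
- by rewrite -last_thead.
- rewrite -last_thead => y yK; rewrite memtE tval_thead; have := subKt eq_t y.
  by rewrite Kout_rev => /(_ yK); rewrite mem_rev => /mem_belast.
- by move=> y /subK0 yp; rewrite memtE tval_thead inE yp orbT.
Qed.
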